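(* Let $A$ be a finite set and $S\subsetneq A$ a proper subset. Suppose that $c\in\mathbb{R}^A$ satisfies (1) $c(a)=0$ for any $a\in S$, (2) $\sum_{a\in A}c(a)=0$, and (3) $c(a)\in\left[-\frac{2}{|A\setminus S|+1},\,1\right]$ for any $a\in A\setminus S$. Then the function $g^{S,c}:\Delta(A)\to\mathbb{R}$ defined by $g^{S,c}(x)=h^S(x)\,(1-c^Tx)$ is tangential over $\Delta(A)$. As a consequence, against any sequence of payoff gradients $p^1,p^2,\dots\in\mathbb{R}^A$ with $\|p^t\|\le G$, online gradient ascent over $\Delta(A)$ with non-increasing step sizes $\eta_t$ satisfies $$\frac1T\sum_{t=1}^T\big\langle\nabla g^{S,c}(x^t),p^t\big\rangle\ \le\ \frac{4(2+\|c\|)}{T\eta_T}+\frac{\sum_{t=1}^T\eta_t}{T}\cdot4(1+2\|c\|)G^2.$$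
   Context: $\Delta(A)=\{x\in\mathbb{R}^A:x\ge0,\ \sum_ax(a)=1\}$, and $\|\cdot\|$ is the Euclidean norm. The function $h^S$ is the polynomial $$h^S(x)=-\frac{1}{2|A\setminus S|}\Big(1-\sum_{a\in A\setminus S}x(a)\Big)^2-\frac12\sum_{a\in S}x(a)^2 ,$$ and gradients are those of the polynomial expressions on $\mathbb{R}^A$, evaluated at points of $\Delta(A)$. A function $g$ is tangential over $\Delta(A)$ if for every $x\in\Delta(A)$, $\nabla g(x)$ lies in the tangent cone of $\Delta(A)$ at $x$, i.e. $\sum_a\nabla g(x)_a=0$ and $\nabla g(x)_a\ge0$ for every $a$ with $x(a)=0$. Online gradient ascent: from an arbitrary $x^1\in\Delta(A)$, $x^{t+1}=\Pi_{\Delta(A)}[x^t+\eta_tp^t]$, where $\Pi$ is Euclidean projection and $\eta_t>0$ is non-increasing. *)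

(* Defs.v *)
From mathcomp Require Import all_boot all_order all_algebra.
From mathcomp Require Import classical_sets reals topology normedtype derive.

Set Implicit Arguments.
Unset Strict Implicit.
Unset Printing Implicit Defensive.

Import Order.TTheory GRing.Theory Num.Theory.
Import numFieldNormedType.Exports.

Local Open Scope ring_scope.
Local Open Scope classical_set_scope.

Section Defs.
Context {R : realType} {A : finType}.

(* R^A is {ffun A -> R}.  The Euclidean structure is defined by hand because
   the library norm on finite-dimensional spaces is the sup norm. *)
Implicit Types (x y v c : {ffun A -> R}) (S : {set A}).

Definition dot x y : R := \sum_a x a * y a.

Definition enorm x : R := Num.sqrt (dot x x).

Definition simplex : set {ffun A -> R} :=
  [set x | (forall a, 0 <= x a) /\ \sum_a x a = 1].

(* Euclidean gradient: the vector of the partial derivatives on all of R^A,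
   the a-th one being the derivative at x a of f along the a-th coordinate. *)
Definition grad (f : {ffun A -> R} -> R) x : {ffun A -> R} :=
  [ffun a => (fun t : R => f [ffun b => if b == a then t else x b])^`() (x a)].

(* Tangent cone of the simplex at a point x of the simplex. *)
Definition tangent_cone x : set {ffun A -> R} :=
  [set v | \sum_a v a = 0 /\ (forall a, x a = 0 -> 0 <= v a)].

(* The function is given on R^A, as a (polynomial) expression whose gradient is
   taken in R^A, but the condition only concerns the points of the simplex. *)
Definition tangential (f : {ffun A -> R} -> R) : Prop :=
  forall x, simplex x -> tangent_cone x (grad f x).

(* z is the Euclidean projection of y on K (unique for a convex set K). *)
Definition is_proj (K : set {ffun A -> R}) y z : Prop :=
  K z /\ forall w, K w -> enorm [ffun a => y a - z a] <= enorm [ffun a => y a - w a].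

(* Sequences are indexed from 1; the value at 0 is irrelevant. *)
Definition online_gradient_ascent (eta : nat -> R) (p x : nat -> {ffun A -> R}) :
    Prop :=
  simplex (x 1%N) /\
  forall t, (1 <= t)%N ->
    is_proj simplex [ffun a => x t a + eta t * p t a] (x t.+1).

Definition h S x : R :=
  - (2 * #|~: S|%:R)^-1 * (1 - \sum_(a in ~: S) x a) ^+ 2
  - 2^-1 * \sum_(a in S) x a ^+ 2.

Definition g S c x : R := h S x * (1 - dot c x).

End Defs.

(* Main.v *)
(** On the simplex the mass [s] of [S] satisfies [s <= 1 - c^T x] by [c <= 1], and
    [- h x <= s^2 (n + 1) / (2 n)] with [n = |A \ S|]; the lower bound on [c] is
    exactly what makes the gradient of [g] nonnegative on the vanishing
    coordinates outside [S].
    For the regret, tangentiality at the projected point [y = x^(t+1)] and the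
    optimality condition of the projection give
    [eta <grad g y, p> <= <grad g y, y - x>].  The right-hand side is at most
    [g y - g x] up to [O(|y - x|^2)], and [|y - x| <= eta G], so each step costs
    [(g y - g x) / eta + O(eta G^2)]; the first terms are summed by parts, since
    [g] is bounded and the step sizes are non-increasing. *)
Require Import Defs.
From mathcomp Require Import all_boot all_order all_algebra.
From mathcomp Require Import classical_sets reals topology normedtype derive.

Import Order.TTheory GRing.Theory Num.Theory.
Import numFieldNormedType.Exports.

Local Open Scope ring_scope.

From mathcomp Require Import boolp functions lra ring.

(** * Euclidean geometry of [{ffun A -> R}] *)

Section Euclidean.
Set Implicit Arguments.
Unset Strict Implicit.
Context {R : realType} {A : finType}.
Implicit Types (x y z v w : {ffun A -> R}) (k : R).

Lemma dotC x y : dot x y = dot y x.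
Proof. by apply: eq_bigr => a _; rewrite mulrC. Qed.

Lemma dotDl x y z : dot (x + y) z = dot x z + dot y z.
Proof. by rewrite -big_split; apply: eq_bigr => a _; rewrite ffunE mulrDl. Qed.

Lemma dotZl k x z : dot (k *: x) z = k * dot x z.
Proof. by rewrite mulr_sumr; apply: eq_bigr => a _; rewrite ffunE mulrA. Qed.

Lemma dotNl x z : dot (- x) z = - dot x z.
Proof. by rewrite -scaleN1r dotZl mulN1r. Qed.

Lemma dotDr x y z : dot z (x + y) = dot z x + dot z y.
Proof. by rewrite dotC dotDl !(dotC z). Qed.

Lemma dotZr k x z : dot z (k *: x) = k * dot z x.
Proof. by rewrite dotC dotZl (dotC z). Qed.

Lemma dotNr x z : dot z (- x) = - dot z x.
Proof. by rewrite dotC dotNl (dotC z). Qed.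

Definition dotE := (dotDl, dotDr, dotZl, dotZr, dotNl, dotNr).

Lemma dot_ge0 x : 0 <= dot x x.
Proof. by apply: sumr_ge0 => a _; rewrite -expr2 sqr_ge0. Qed.

Lemma enorm_ge0 x : 0 <= enorm x.
Proof. exact: sqrtr_ge0. Qed.

Lemma sqr_enorm x : enorm x ^+ 2 = dot x x.
Proof. by rewrite sqr_sqrtr ?dot_ge0. Qed.

Lemma enorm_eq0 x : enorm x = 0 -> x = 0.
Proof.
move=> x0; have /eqP : dot x x = 0 by rewrite -sqr_enorm x0 expr0n.
rewrite psumr_eq0 => [/allP xx0|a _]; last by rewrite -expr2 sqr_ge0.
apply/ffunP => a; rewrite ffunE.
by have := xx0 a (mem_index_enum _); rewrite -expr2 sqrf_eq0 => /eqP.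
Qed.

Lemma enormN x : enorm (- x) = enorm x.
Proof. by rewrite /enorm !dotE opprK. Qed.

(** Cauchy-Schwarz: expanding the squared norm of [|y| x - |x| y] gives
    [2 |x| |y| (|x| |y| - <x, y>) >= 0]. *)
Lemma le_dot_enorm x y : dot x y <= enorm x * enorm y.
Proof.
have [/enorm_eq0 ->|x0] := eqVneq (enorm x) 0.
  by rewrite -{1}(scale0r (0 : {ffun A -> R})) dotZl mul0r mulr_ge0 ?enorm_ge0.
have [/enorm_eq0 ->|y0] := eqVneq (enorm y) 0.
  by rewrite -{1}(scale0r (0 : {ffun A -> R})) dotZr mul0r mulr_ge0 ?enorm_ge0.
have xy0 : 0 < enorm x * enorm y.
  by rewrite mulr_gt0 // lt_neqAle eq_sym ?x0 ?y0 enorm_ge0.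
have := dot_ge0 (enorm y *: x - enorm x *: y).
rewrite !dotE (dotC y x) -!sqr_enorm => xy.
by rewrite -subr_ge0 -(pmulr_rge0 _ xy0); lra.
Qed.

Lemma normr_dot_le x y : `|dot x y| <= enorm x * enorm y.
Proof.
rewrite ler_norml le_dot_enorm andbT lerNl -dotNl -(enormN x).
exact: le_dot_enorm.
Qed.

(** * The simplex, its tangent cones and projection onto it *)

Lemma simplex_le1 x a : simplex x -> x a <= 1.
Proof.
by case=> x0 <-; rewrite (bigD1 a) //= lerDl sumr_ge0.
Qed.

Lemma simplex_enorm_le1 x : simplex x -> enorm x <= 1.
Proof.
move=> Kx; have [x0 x1] := Kx; rewrite -(expr_le1 (n := 2)) ?enorm_ge0 //.
rewrite sqr_enorm -x1; apply: ler_sum => a _.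
by rewrite ler_piMl // simplex_le1.
Qed.

Lemma sum_sub_simplex x y : simplex x -> simplex y -> \sum_a (y - x) a = 0.
Proof.
move=> [_ x1] [_ y1]; under eq_bigr do rewrite !ffunE.
by rewrite sumrB x1 y1 subrr.
Qed.

Lemma tangent_cone_sub x y : simplex x -> simplex y -> tangent_cone y (x - y).
Proof.
move=> Kx Ky; split; first exact: sum_sub_simplex.
by move=> a ya0; rewrite !ffunE ya0 subr0; case: Kx.
Qed.

Lemma tangent_cone_feasible y v : simplex y -> tangent_cone y v ->
  exists2 e0 : R, 0 < e0 & forall e, 0 <= e <= e0 -> simplex (y + e *: v).
Proof.
move=> [y0 y1] [v0 vy].
(* [m] dominates every ratio [|v a| / y a], so steps up to [1 / m] keep positive coordinates
   nonnegative. Where [y a = 0] the quotient is 0 by convention and [v a >= 0] suffices. *)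
pose m := 1 + \sum_a `|v a| / y a.
have q0 a : 0 <= `|v a| / y a by rewrite divr_ge0.
have m0 : 0 < m by rewrite ltr_pwDl // sumr_ge0.
exists m^-1; rewrite ?invr_gt0 // => e /andP[e0 em]; split => [a|]; last first.
  under eq_bigr do rewrite !ffunE.
  by rewrite big_split /= -mulr_sumr v0 y1 mulr0 addr0.
rewrite !ffunE -[_ *: _]/(e * v a); have [/[dup] ya0 /vy va|ya] := eqVneq (y a) 0.
  by rewrite ya0 add0r mulr_ge0.
have {}ya : 0 < y a by rewrite lt_neqAle eq_sym ya y0.
suff : e * `|v a| <= y a.
  move=> ev; have : e * - v a <= e * `|v a| by rewrite ler_wpM2l // -normrN ler_norm.
  by lra.
have vm : `|v a| / y a <= m.
  by rewrite /m (bigD1 a) //= addrCA lerDl addr_ge0 // sumr_ge0.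
have : e * m <= 1 by rewrite -(mulVf (lt0r_neq0 m0)) ler_wpM2r // ltW.
rewrite ler_pdivrMr // in vm => em1.
apply: (le_trans (ler_wpM2l e0 vm)); rewrite mulrA ger_pMl //.
Qed.

(* First-order optimality: moving from [y] by a small multiple of [v] cannot
   decrease the distance to [z]. *)
Lemma proj_tangent_le0 z y v :
  is_proj simplex z y -> tangent_cone y v -> dot (z - y) v <= 0.
Proof.
move=> [Ky zy] /(tangent_cone_feasible Ky)[e0 e0_gt0 Kv].
rewrite leNgt; apply/negP => k0; set k := dot _ _ in k0.
have v1 : 0 < 1 + dot v v by rewrite ltr_pwDl ?dot_ge0.
(* The squared distance changes by [- 2 e k + e^2 |v|^2], which is negative once [e |v|^2 < 2 k];
   the added 1 keeps the denominator positive. *)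
pose e := Num.min e0 (k / (1 + dot v v)).
have e_gt0 : 0 < e by rewrite lt_min e0_gt0 divr_gt0.
have /Kv/zy : 0 <= e <= e0 by rewrite ltW //= ge_min lexx.
have -> : [ffun a => z a - y a] = z - y by apply/ffunP => a; rewrite !ffunE.
have -> : [ffun a => z a - (y + e *: v) a] = z - y - e *: v.
  by apply/ffunP => a; rewrite !ffunE opprD addrA.
rewrite -(ler_pXn2r (n := 2)) ?nnegrE ?enorm_ge0 // !sqr_enorm.
have -> : dot (z - y - e *: v) (z - y - e *: v) =
    dot (z - y) (z - y) - 2 * e * k + e * e * dot v v.
  rewrite /k; move: (z - y) => q; rewrite !dotE (dotC v q); ring.
move=> hq.
have ek : e * (1 + dot v v) <= k by rewrite -ler_pdivlMr // ge_min lexx orbT.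
have : e * (2 * k - e * dot v v) <= 0 by lra.
by rewrite pmulr_rle0 // => ?; lra.
Qed.

(** Optimality at [y] in the direction [x - y] reads [|d|^2 <= e <p, d>] with [d = y - x];
    Cauchy-Schwarz then allows division by [|d|]. *)
Lemma proj_step_le x y p (e G : R) : simplex x -> 0 <= e -> enorm p <= G ->
  is_proj simplex (x + e *: p) y -> enorm (y - x) <= e * G.
Proof.
move=> Kx e0 pG proj; have [Ky _] := proj.
have := proj_tangent_le0 proj (tangent_cone_sub Kx Ky).
have -> : x + e *: p - y = e *: p - (y - x) by rewrite opprB (addrC x) addrA.
have -> : x - y = - (y - x) by rewrite opprB.
move: (y - x) => d; rewrite !dotE -sqr_enorm => hd.
have := le_dot_enorm p d; have := enorm_ge0 d => d0 pd.
have [d00|d00] := eqVneq (enorm d) 0.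
  by rewrite d00 mulr_ge0 // (le_trans _ pG) ?enorm_ge0.
rewrite -(ler_pM2r (_ : 0 < enorm d)); last by rewrite lt_neqAle eq_sym d00.
have : e * dot p d <= e * (G * enorm d).
  by rewrite ler_wpM2l // (le_trans pd) // ler_wpM2r.
by lra.
Qed.

End Euclidean.

(** * The quadratic [h], its exact expansion and the gradient of [g] *)

Section Potential.
Context {R : realType} {A : finType} (S : {set A}).
Hypothesis hS : S \proper [set: A].
Set Implicit Arguments.
Unset Strict Implicit.
Implicit Types (c d p w x y z : {ffun A -> R}) (t s : R).

Local Notation n := (#|~: S|%:R : R).

(** Closed form of the gradient of [h S]. *)
Definition hgrad x : {ffun A -> R} :=
  [ffun a => if a \in S then - x a else (1 - \sum_(b in ~: S) x b) / n].

(* Orthogonal projection on the vectors constant outside [S]; its opposite is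
   the Hessian of [h]. *)
Definition hproj d : {ffun A -> R} :=
  [ffun a => if a \in S then d a else (\sum_(b in ~: S) d b) / n].

Lemma cardC_gt0 : 0 < n.
Proof.
have [_ [a _ aS]] := properP hS.
by rewrite ltr0n card_gt0; apply/set0Pn; exists a; rewrite inE.
Qed.

Let n_neq0 : n != 0. Proof. by rewrite gt_eqF ?cardC_gt0. Qed.

Lemma sum_split (F : A -> R) :
  \sum_a F a = \sum_(a in ~: S) F a + \sum_(a in S) F a.
Proof.
rewrite (bigID (mem S)) /= addrC; congr (_ + _).
by apply: eq_bigl => a; rewrite inE.
Qed.

Lemma hproj_dot d w :
  dot (hproj d) w = (\sum_(a in ~: S) d a) * (\sum_(a in ~: S) w a) / n
                    + \sum_(a in S) d a * w a.
Proof.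
rewrite /dot sum_split; congr (_ + _); last first.
  by apply: eq_bigr => a aS; rewrite ffunE aS.
rewrite mulrAC mulr_sumr; apply: eq_bigr => a; rewrite inE ffunE => /negbTE ->.
by [].
Qed.

Lemma sumC_cst (k : R) : \sum_(a in ~: S) k = n * k.
Proof. by rewrite sumr_const mulr_natl. Qed.

Lemma sumC_hproj d : \sum_(a in ~: S) hproj d a = \sum_(a in ~: S) d a.
Proof.
transitivity (\sum_(a in ~: S) (\sum_(b in ~: S) d b) / n); last first.
  by rewrite sumC_cst mulrC divfK.
by apply: eq_bigr => a; rewrite inE ffunE => /negbTE ->.
Qed.

Lemma sumC_hgrad x :
  \sum_(a in ~: S) hgrad x a = 1 - \sum_(a in ~: S) x a.
Proof.
transitivity (\sum_(a in ~: S) (1 - \sum_(b in ~: S) x b) / n); last first.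
  by rewrite sumC_cst mulrC divfK.
by apply: eq_bigr => a; rewrite inE ffunE => /negbTE ->.
Qed.

Lemma hproj_dot_hproj d w : dot (hproj d) (hproj w) = dot (hproj d) w.
Proof.
rewrite !hproj_dot sumC_hproj; congr (_ + _).
by apply: eq_bigr => a aS; rewrite ffunE aS.
Qed.

(** [hgrad x] is constant outside [S], hence fixed by the self-adjoint projection [hproj]. *)
Lemma hproj_dot_hgrad d x : dot (hproj d) (hgrad x) = dot d (hgrad x).
Proof.
rewrite hproj_dot sumC_hgrad /dot sum_split; congr (_ + _).
rewrite -mulrA mulr_suml; apply: eq_bigr => a; rewrite inE ffunE => /negbTE ->.
by [].
Qed.

Lemma hprojZ s d : hproj (s *: d) = s *: hproj d.
Proof.
apply/ffunP => a; rewrite !ffunE -[RHS]/(s * _); case: ifP => // _.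
by under eq_bigr do rewrite ffunE; rewrite -mulr_sumr mulrA.
Qed.

Lemma hgrad_sub x y : hgrad y - hgrad x = - hproj (y - x).
Proof.
apply/ffunP => a; rewrite !ffunE; case: ifP => _; first by ring.
under [in RHS]eq_bigr do rewrite !ffunE.
by rewrite sumrB; ring.
Qed.

Lemma enorm_hproj_le d : enorm (hproj d) <= enorm d.
Proof.
have [->|d0] := eqVneq (enorm (hproj d)) 0; first exact: enorm_ge0.
rewrite -(ler_pM2l (_ : 0 < enorm (hproj d))); last first.
  by rewrite lt_neqAle eq_sym d0 enorm_ge0.
by rewrite -expr2 sqr_enorm hproj_dot_hproj le_dot_enorm.
Qed.

(** This identity turns bounds on [h] into bounds on its gradient: the [n] equal coordinates [m / n]
    outside [S] contribute [m^2 / n]. *)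
Lemma h_hgrad x : h S x = - (2^-1 * dot (hgrad x) (hgrad x)).
Proof.
rewrite /h /dot sum_split.
have -> : \sum_(a in ~: S) hgrad x a * hgrad x a =
    (1 - \sum_(a in ~: S) x a) ^+ 2 / n.
  transitivity (\sum_(a in ~: S) ((1 - \sum_(b in ~: S) x b) / n) ^+ 2).
    by apply: eq_bigr => a; rewrite inE ffunE => /negbTE ->.
  by rewrite sumC_cst; field.
have -> : \sum_(a in S) hgrad x a * hgrad x a = \sum_(a in S) x a ^+ 2.
  by apply: eq_bigr => a aS; rewrite ffunE aS; ring.
by field.
Qed.

(** The second-order Taylor expansion is exact because [h] is quadratic. *)
Lemma h_sub x y : h S y - h S x =
  dot (hgrad x) (y - x) - 2^-1 * dot (hproj (y - x)) (hproj (y - x)).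
Proof.
have -> : h S y = - (2^-1 * dot (hgrad x - hproj (y - x)) (hgrad x - hproj (y - x))).
  by rewrite h_hgrad -hgrad_sub addrC subrK.
rewrite h_hgrad (dotC (hgrad x) (y - x)) -(hproj_dot_hgrad (y - x)).
move: (hproj _) => d; rewrite !dotE (dotC (hgrad x) d); lra.
Qed.

Lemma h_le0 x : h S x <= 0.
Proof. by rewrite h_hgrad oppr_le0 mulr_ge0 ?dot_ge0 ?invr_ge0 ?ler0n. Qed.

Lemma grad_gE c x a :
  grad (g S c) x a = (1 - dot c x) * hgrad x a - h S x * c a.
Proof.
rewrite ffunE.
pose e : {ffun A -> R} := [ffun b => (b == a)%:R].
have dote w : dot w e = w a.
  rewrite /dot (bigD1 a) //= ffunE eqxx mulr1 big1 ?addr0 // => b /negbTE ba.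
  by rewrite ffunE ba mulr0.
pose beta := 2^-1 * dot (hproj e) (hproj e).
(* Along a coordinate line, the expansion of [h] makes [g] an explicit cubic in [t - x a]. *)
have -> : (fun t => g S c [ffun b => if b == a then t else x b]) =
  (fun t => (h S x + (t - x a) * hgrad x a - (t - x a) ^+ 2 * beta)
            * (1 - dot c x - (t - x a) * c a)).
  apply: funext => t.
  have -> : [ffun b => if b == a then t else x b] = x + (t - x a) *: e.
    apply/ffunP => b; rewrite !ffunE -[_ *: _]/(_ * _).
    by case: eqP => [->|_] /=; ring.
  move: (t - x a) => s.
  have := h_sub x (x + s *: e).
  have -> : x + s *: e - x = s *: e by rewrite addrAC subrr add0r.
  rewrite hprojZ.
  rewrite !dotE !dote => he; rewrite /g !dotE dote.
  have -> : h S (x + s *: e) = h S x + s * hgrad x a - s ^+ 2 * beta.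
    rewrite -[LHS](subrK (h S x)) he /beta; ring.
  by ring.
rewrite derive1E.
(* Written with [u] and constants, the cubic is differentiated by instance resolution; [u] vanishes
   at [x a], so only its linear coefficient survives. *)
pose u : R -> R := id - cst (x a).
have du : is_derive (x a) 1 u 1 by apply: is_derive_eq; rewrite subr0.
have -> : (fun t => (h S x + (t - x a) * hgrad x a - (t - x a) ^+ 2 * beta)
            * (1 - dot c x - (t - x a) * c a)) =
  (cst (h S x) + u * cst (hgrad x a) - u * u * cst beta)
     * (cst (1 - dot c x) - u * cst (c a)).
  by apply: funext => t.
apply: derive_val; apply: is_derive_eq.
rewrite /u !fctE /= !subrr -![_ *: _]/(_ * _); ring.
Qed.

Lemma gradE c x : grad (g S c) x = (1 - dot c x) *: hgrad x - h S x *: c.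
Proof. by apply/ffunP => a; rewrite grad_gE !ffunE. Qed.

(** * Bounds for [h] on the simplex *)

Lemma sum_simplex x : simplex x ->
  1 - \sum_(a in ~: S) x a = \sum_(a in S) x a.
Proof. by case=> _ <-; rewrite sum_split addrAC subrr add0r. Qed.

Lemma sumS_ge0 x : simplex x -> 0 <= \sum_(a in S) x a.
Proof. by case=> x0 _; apply: sumr_ge0. Qed.

Lemma sumS_le1 x : simplex x -> \sum_(a in S) x a <= 1.
Proof.
by move=> Kx; rewrite -sum_simplex // gerBl sumr_ge0 // => a _; case: Kx.
Qed.

Lemma sumS_sqr_le x : simplex x ->
  \sum_(a in S) x a ^+ 2 <= (\sum_(a in S) x a) ^+ 2.
Proof.
case=> x0 _; rewrite expr2 mulr_suml; apply: ler_sum => a aS.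
by rewrite expr2 ler_wpM2l // (bigD1 a) //= lerDl sumr_ge0.
Qed.

Lemma h_ge x : simplex x ->
  - h S x <= (\sum_(a in S) x a) ^+ 2 * (n + 1) / (2 * n).
Proof.
move=> Kx; have := sumS_sqr_le Kx; rewrite /h sum_simplex //.
set s := \sum_(a in S) x a => hs.
have -> : s ^+ 2 * (n + 1) / (2 * n) = (2 * n)^-1 * s ^+ 2 + 2^-1 * s ^+ 2.
  by field.
by lra.
Qed.

Lemma h_ge_N1 x : simplex x -> -1 <= h S x.
Proof.
move=> Kx; rewrite lerNl; apply: (le_trans (h_ge Kx)).
have n1 : 1 <= n by rewrite ler1n -(ltr0n R) cardC_gt0.
rewrite ler_pdivrMr ?mulr_gt0 ?cardC_gt0 // mul1r.
have s1 : (\sum_(a in S) x a) ^+ 2 <= 1.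
  by rewrite expr_le1 // ?sumS_ge0 ?sumS_le1.
have n1_ge0 : 0 <= n + 1 by lra.
by have := ler_wpM2r n1_ge0 s1; lra.
Qed.

(** [|hgrad x|^2 = - 2 h x <= 2], which is below 4. *)
Lemma enorm_hgrad_le2 x : simplex x -> enorm (hgrad x) <= 2.
Proof.
move=> Kx; rewrite -(ler_pXn2r (n := 2)) ?nnegrE ?enorm_ge0 ?ler0n // sqr_enorm.
have := h_ge_N1 Kx; rewrite h_hgrad; lra.
Qed.

(** * Bounds for [g] and its tangentiality *)

Section Perturbation.
Context (c : {ffun A -> R}).
Hypothesis hc1 : forall a : A, a \in S -> c a = 0.
Hypothesis hc2 : \sum_(a : A) c a = 0.
Hypothesis hc3 : forall a : A, a \in ~: S -> c a \in `[- (2 / (#|~: S| + 1)%:R), 1].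

Lemma factor_ge x : simplex x -> \sum_(a in S) x a <= 1 - dot c x.
Proof.
move=> Kx; rewrite -sum_simplex // lerD2l lerN2 /dot sum_split.
rewrite [X in _ + X]big1 ?addr0 => [|a /hc1 ->]; last by rewrite mul0r.
apply: ler_sum => a /hc3; rewrite in_itv /= => /andP[_ ca].
by rewrite ler_piMl //; case: Kx.
Qed.

Lemma factor_ge0 x : simplex x -> 0 <= 1 - dot c x.
Proof. by move=> Kx; apply: le_trans (factor_ge Kx); exact: sumS_ge0. Qed.

Lemma factor_le x : simplex x -> 1 - dot c x <= 1 + enorm c.
Proof.
move=> Kx; rewrite lerD2l -dotNl; apply: (le_trans (le_dot_enorm _ _)).
by rewrite enormN ler_piMr ?enorm_ge0 ?simplex_enorm_le1.
Qed.

Lemma g_le0 x : simplex x -> g S c x <= 0.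
Proof. by move=> Kx; rewrite mulr_le0_ge0 ?h_le0 ?factor_ge0. Qed.

Lemma g_ge x : simplex x -> - (1 + enorm c) <= g S c x.
Proof.
move=> Kx; have := h_ge_N1 Kx; have := h_le0 x; rewrite /g => h0 h1.
have := factor_le Kx; have := factor_ge0 Kx; nra.
Qed.

Lemma sum_hgrad x : simplex x -> \sum_a hgrad x a = 0.
Proof.
move=> Kx; rewrite sum_split sumC_hgrad sum_simplex // -big_split big1 //= => a aS.
by rewrite ffunE aS subrr.
Qed.

Lemma tangential_g : tangential (g S c).
Proof.
move=> x Kx; split.
  under eq_bigr do rewrite grad_gE.
  by rewrite sumrB -!mulr_sumr hc2 sum_hgrad // !mulr0 subrr.
move=> a xa; rewrite grad_gE ffunE.
case: ifP => aS; first by rewrite hc1 // xa oppr0 !mulr0 subrr.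
have /hc3 : a \in ~: S by rewrite inE aS.
rewrite in_itv /= natrD => /andP[ca _].
rewrite sum_simplex //.
have := factor_ge Kx; have := h_ge Kx; have := h_le0 x; have := sumS_ge0 Kx.
set s := \sum_(a in S) x a; set l := 1 - dot c x => s0 h0 h1 sl.
have n0 := cardC_gt0.
have n10 : 0 < n + 1 by rewrite addr_gt0.
(* Both terms of the gradient coordinate are compared with [s^2 / n]: the factor [(n + 1) / (2 n)]
   bounding [- h] cancels against [2 / (n + 1)], the bound on [- c a]. *)
have lo : s ^+ 2 / n <= l * (s / n).
  by rewrite mulrA ler_wpM2r ?invr_ge0 ?ler0n // expr2 ler_wpM2r.
have hi : - h S x * (2 / (n + 1)) <= s ^+ 2 / n.
  have -> : s ^+ 2 / n = s ^+ 2 * (n + 1) / (2 * n) * (2 / (n + 1)).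
    by field; rewrite n_neq0 gt_eqF.
  by rewrite ler_wpM2r // divr_ge0 // ltW.
have := ler_wpM2l (_ : 0 <= - h S x) ca.
by rewrite oppr_ge0 => /(_ h0); lra.
Qed.

(** * Second-order estimates for [g] and the cost of one ascent step *)

(* With [d = y - x] the polynomial [g] satisfies
   [g y - g x = <grad g y, d> + <grad h y, d><c, d> + (1 - c^T x) |P d|^2 / 2],
   where [P] is [hproj]. *)
Lemma grad_g_dot_le x y : simplex x -> simplex y ->
  dot (grad (g S c) y) (y - x) <=
  g S c y - g S c x + 2 * enorm c * enorm (y - x) ^+ 2.
Proof.
move=> Kx Ky; set d := y - x.
have hxy : h S x = h S y - dot (hgrad y) d - 2^-1 * dot (hproj d) (hproj d).
  have := h_sub y x; have -> : x - y = - d by rewrite opprB.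
  by rewrite -[in hproj _]scaleN1r hprojZ scaleN1r !dotE; lra.
have cxy : dot c x = dot c y - dot c d by rewrite /d !dotE; ring.
clearbody d; rewrite gradE !dotE /g.
(* The curvature term has the favourable sign and is dropped; only the cross term costs
   something. *)
have q0 : 0 <= 2^-1 * dot (hproj d) (hproj d) * (1 - dot c x).
  by rewrite !mulr_ge0 ?dot_ge0 ?factor_ge0 ?invr_ge0 ?ler0n.
have cr : - (dot (hgrad y) d * dot c d) <= 2 * enorm c * enorm d ^+ 2.
  apply: (le_trans (ler_norm _)); rewrite normrN normrM.
  have -> : 2 * enorm c * enorm d ^+ 2 = (2 * enorm d) * (enorm c * enorm d).
    by ring.
  apply: ler_pM => //; last exact: normr_dot_le.
  apply: (le_trans (normr_dot_le _ _)).
  by rewrite ler_wpM2r ?enorm_ge0 ?enorm_hgrad_le2.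
move: q0; rewrite hxy cxy; lra.
Qed.

(** The gradient difference is [(1 - <c, x>) P d + <c, d> hgrad y + (h y - h x) c], with [P] the
    projection [hproj]. The three terms contribute [1 + |c|], [2 |c|] and [2 |c|]. *)
Lemma grad_g_lipschitz x y p : simplex x -> simplex y ->
  dot (grad (g S c) x) p - dot (grad (g S c) y) p <=
  (1 + 5 * enorm c) * enorm (y - x) * enorm p.
Proof.
move=> Kx Ky; set d := y - x.
have cxy : dot c x = dot c y - dot c d by rewrite /d !dotE; ring.
have Nxy : hgrad y = hgrad x - hproj d by rewrite -hgrad_sub addrC subrK.
have hxy : `|h S y - h S x| <= 2 * enorm d.
  (* The trapezoidal rule is exact for a quadratic. *)
  have -> : h S y - h S x = 2^-1 * (dot (hgrad x) d + dot (hgrad y) d).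
    by rewrite h_sub -/d Nxy hproj_dot_hproj; clearbody d; rewrite !dotE; lra.
  have bnd z : simplex z -> `|dot (hgrad z) d| <= 2 * enorm d.
    move=> Kz; apply: (le_trans (normr_dot_le _ _)).
    by rewrite ler_wpM2r ?enorm_ge0 ?enorm_hgrad_le2.
  have := bnd x Kx; have := bnd y Ky; rewrite !ler_norml.
  by move=> /andP[? ?] /andP[? ?]; apply/andP; split; lra.
have dp0 : 0 <= enorm d * enorm p by rewrite mulr_ge0 ?enorm_ge0.
have t1 : dot (hproj d) p * (1 - dot c x) <= enorm d * enorm p * (1 + enorm c).
  apply: (le_trans (ler_norm _)); rewrite normrM; apply: ler_pM => //.
    apply: (le_trans (normr_dot_le _ _)).
    by rewrite ler_wpM2r ?enorm_ge0 ?enorm_hproj_le.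
  by rewrite ger0_norm ?factor_ge0 ?factor_le.
have t2 : dot (hgrad y) p * dot c d <= 2 * enorm p * (enorm c * enorm d).
  apply: (le_trans (ler_norm _)); rewrite normrM.
  apply: ler_pM => //; last exact: normr_dot_le.
  apply: (le_trans (normr_dot_le _ _)).
  by rewrite ler_wpM2r ?enorm_ge0 ?enorm_hgrad_le2.
have t3 : (h S y - h S x) * dot c p <= 2 * enorm d * (enorm c * enorm p).
  apply: (le_trans (ler_norm _)); rewrite normrM.
  by apply: ler_pM => //; exact: normr_dot_le.
rewrite !gradE !dotE.
have -> : dot (hgrad x) p = dot (hgrad y) p + dot (hproj d) p.
  by rewrite Nxy !dotE; ring.
move: t2; rewrite cxy in t1 *; lra.
Qed.

Lemma ascent_step x y p (e G : R) : simplex x -> 0 < e -> enorm p <= G ->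
  is_proj simplex (x + e *: p) y ->
  dot (grad (g S c) x) p <=
  (g S c y - g S c x) / e + e * (4 * (1 + 2 * enorm c) * G ^+ 2).
Proof.
move=> Kx e0 pG proj; have [Ky _] := proj.
have yx := proj_step_le Kx (ltW e0) pG proj.
have G0 : 0 <= G by rewrite (le_trans _ pG) ?enorm_ge0.
have c0 := enorm_ge0 c; have d0 := enorm_ge0 (y - x).
have lip := grad_g_lipschitz p Kx Ky.
have asc := grad_g_dot_le Kx Ky.
(* Tangentiality enters here: the gradient at the new point [y] is an admissible direction in the
   optimality condition. *)
have := proj_tangent_le0 proj (tangential_g Ky).
have -> : x + e *: p - y = e *: p - (y - x) by rewrite opprB (addrC x) addrA.
rewrite dotC dotDr dotNr dotZr => opt.
have b1 : enorm (y - x) * enorm p <= e * G * G.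
  by rewrite ler_pM ?enorm_ge0.
have b2 : enorm (y - x) ^+ 2 <= (e * G) ^+ 2.
  by rewrite ler_pXn2r ?nnegrE ?mulr_ge0 ?(ltW e0).
rewrite -(ler_pM2l e0) mulrDr mulrCA divff ?gt_eqF // mulr1.
have {}b1 : (1 + 5 * enorm c) * (enorm (y - x) * enorm p) <=
    (1 + 5 * enorm c) * (e * G * G).
  by rewrite ler_wpM2l //; lra.
have {}lip : e * (dot (grad (g S c) x) p - dot (grad (g S c) y) p) <=
    e * ((1 + 5 * enorm c) * (e * G * G)).
  by rewrite ler_wpM2l ?(ltW e0) // (le_trans lip) // -mulrA.
have {}b2 : 2 * enorm c * enorm (y - x) ^+ 2 <= 2 * enorm c * (e * G) ^+ 2.
  by rewrite ler_wpM2l // mulr_ge0.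
(* The costs [1 + 5 |c|] and [2 |c|] leave the slack [(3 + |c|) (e G)^2] below
   [4 (1 + 2 |c|) (e G)^2]. *)
have := sqr_ge0 (e * G).
have : 0 <= enorm c * (e * G) ^+ 2 by rewrite mulr_ge0 ?sqr_ge0.
lra.
Qed.

End Perturbation.
End Potential.

(** * Summation over time and the regret bound *)

Lemma sum_diff_div_le (R : realType) (f eta : nat -> R) (M : R) :
  (forall t, (1 <= t)%N -> - M <= f t) ->
  (forall t, (1 <= t)%N -> 0 < eta t) ->
  (forall s t, (1 <= s)%N -> (s <= t)%N -> eta t <= eta s) ->
  forall T, (1 <= T)%N ->
  \sum_(1 <= t < T.+1) (f t.+1 - f t) / eta t <= (f T.+1 + M) / eta T.
Proof.
move=> fM eta0 etaN [//|T _]; elim: T => [|T IH].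
  rewrite big_nat1 ler_wpM2r ?invr_ge0 ?(ltW (eta0 _ _)) //.
  by have := fM 1%N isT; lra.
rewrite big_nat_recr //=.
(* Since [f + M] is nonnegative, passing to the smaller step size only increases the quotient, and
   the sum telescopes. *)
have : (f T.+2 + M) / eta T.+1 <= (f T.+2 + M) / eta T.+2.
  rewrite ler_wpM2l //; first by have := fM T.+2 isT; lra.
  by rewrite lef_pV2 ?posrE ?eta0 ?etaN.
move: IH; rewrite !mulrDl; lra.
Qed.

Theorem theorem4p1 (R : realType) (A : finType) (S : {set A})
    (hS : S \proper [set: A]) (c : {ffun A -> R})
    (hc1 : forall a : A, a \in S -> c a = 0)
    (hc2 : \sum_(a : A) c a = 0)
    (hc3 : forall a : A, a \in ~: S -> c a \in `[- (2 / (#|~: S| + 1)%:R), 1]) :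
  tangential (g S c) /\
  (forall (p x : nat -> {ffun A -> R}) (eta : nat -> R) (G : R),
    (forall t : nat, (1 <= t)%N -> enorm (p t) <= G) ->
    (forall t : nat, (1 <= t)%N -> 0 < eta t) ->
    (forall s t : nat, (1 <= s)%N -> (s <= t)%N -> eta t <= eta s) ->
    online_gradient_ascent eta p x ->
    forall T : nat, (1 <= T)%N ->
      T%:R^-1 * (\sum_(1 <= t < T.+1) dot (grad (g S c) (x t)) (p t))
      <= 4 * (2 + enorm c) / (T%:R * eta T)
         + (\sum_(1 <= t < T.+1) eta t) / T%:R * (4 * (1 + 2 * enorm c) * G ^+ 2)).
Proof.
split=> [|p x eta G pG eta0 etaN [x1 xS] T T1]; first exact: tangential_g.
have xS' t : (1 <= t)%N -> is_proj simplex (x t + eta t *: p t) (x t.+1).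
  move=> /xS; congr (is_proj _ _ _); apply/ffunP => a; by rewrite !ffunE.
have Kx t : (1 <= t)%N -> simplex (x t).
  by case: t => // -[//|t] _; have [] := xS' t.+1 isT.
have T0 : 0 < T%:R :> R by rewrite ltr0n.
have c0 := enorm_ge0 c.
set K := 4 * (1 + 2 * enorm c) * G ^+ 2.
have steps : \sum_(1 <= t < T.+1) dot (grad (g S c) (x t)) (p t) <=
    \sum_(1 <= t < T.+1) ((g S c (x t.+1) - g S c (x t)) / eta t + eta t * K).
  rewrite !big_nat; apply: ler_sum => t /andP[t1 _].
  by apply: ascent_step => //; auto.
have tele : \sum_(1 <= t < T.+1) (g S c (x t.+1) - g S c (x t)) / eta t <=
    (g S c (x T.+1) + (1 + enorm c)) / eta T.
  apply: (@sum_diff_div_le R (fun t => g S c (x t))) => // t t1.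
  by apply: g_ge => //; exact: Kx.
(* As [g <= 0], the numerator is at most [1 + |c|], well below [4 (2 + |c|)]. *)
have last : (g S c (x T.+1) + (1 + enorm c)) / eta T <=
    4 * (2 + enorm c) / eta T.
  rewrite ler_wpM2r ?invr_ge0 ?(ltW (eta0 _ _)) //.
  have : g S c (x T.+1) <= 0 by apply: g_le0 => //; exact: Kx.
  by lra.
rewrite mulrC ler_pdivrMr // mulrDl.
have -> : 4 * (2 + enorm c) / (T%:R * eta T) * T%:R = 4 * (2 + enorm c) / eta T.
  by field; rewrite !gt_eqF ?eta0.
have -> : (\sum_(1 <= t < T.+1) eta t) / T%:R * K * T%:R =
    \sum_(1 <= t < T.+1) eta t * K.
  by rewrite -mulr_suml; field; rewrite gt_eqF.
rewrite big_split /= in steps.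
lra.
Qed.
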